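(* Let $q$ be a power of a prime. For any multiplicative characters $A,A',B,B',C$ of $\mathbb{F}_q^*$, any $y,t\in\mathbb{F}_q^*\setminus\{1\}$ and any $x\in\mathbb{F}_q$, \begin{align*} &\frac{1}{q-1}\sum_{\theta}\binom{A'\theta}{\theta}F_{3}(A,A'\theta;B,B';C;x,y)\,\theta(t)\\ &=\overline{A'}(1-t)\,F_{3}\left(A,A';B,B';C;x,\frac{y}{1-t}\right)\\ &\quad-\overline{A'}(-t)\,B'(-1)\,\overline{C}(y)\,\overline{B'}C(1-y)\,{}_{2}F_1\left(\begin{matrix}A,B\\ \overline{B'}C\end{matrix}\bigg|-\frac{x(1-y)}{y}\right), \end{align*} where the sum is over all multiplicative characters $\theta$ of $\mathbb{F}_q^*$.
   Context: $\mathbb{F}_q$ is the finite field with $q$ elements. Characters are complex-valued multiplicative characters of $\mathbb{F}_q^*$; every character $\chi$, including the trivial character $\varepsilon$, is extended to $\mathbb{F}_q$ by $\chi(0)=0$. $\overline{\chi}$ is the inverse of $\chi$; juxtaposition of characters is their product, so that e.g. $\overline{B'}C(1-y)$ means $(\overline{B'}C)(1-y)$. For characters $\chi,\lambda$ the Jacobi sum is $J(\chi,\lambda)=\sum_{u\in\mathbb{F}_q}\chi(u)\lambda(1-u)$, and the binomial coefficient of characters $A,B$ is $\binom{A}{B}=B(-1)J(A,\overline{B})$ (no factor $1/q$). For characters $A,B,C$ and $x\in\mathbb{F}_q$, ${}_2F_1\left(\begin{matrix}A,B\\ C\end{matrix}\bigg|x\right)=\varepsilon(x)\,BC(-1)\sum_{y\in\mathbb{F}_q}B(y)\,\overline{B}C(1-y)\,\overline{A}(1-xy)$.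 The finite field Appell series $F_3$ is $$F_{3}(A,A';B,B';C;x,y)=\varepsilon(xy)\,BB'(-1)\sum_{u,v\in\mathbb{F}_q}B(u)\,B'(v)\,C\overline{B}\,\overline{B'}(1-u-v)\,\overline{A}(1-ux)\,\overline{A'}(1-vy).$$ *)

(* Defs.v *)
From HB Require Import structures.
From mathcomp Require Import all_boot all_order all_algebra all_fingroup all_solvable all_field all_character.

Set Implicit Arguments.
Unset Strict Implicit.
Unset Printing Implicit Defensive.

Import Order.TTheory GRing.Theory Num.Theory.
Local Open Scope ring_scope.

(* Multiplicative characters of F are the linear characters of the group of
   units of F. They are handled as class functions, so that A * B and A^-1 are
   the product and the inverse of characters, and 1 is the trivial one. Their
   values are roots of unity, so algC plays the role of the complex numbers. *)
Notation mulCF F := ('CF([set: {unit F}])) (only parsing).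

(* Extension by zero to F. It is applied only after products and inverses have
   been taken in 'CF, so the inverse of a character also vanishes at 0. *)
Definition mcval (F : finFieldType) (chi : mulCF F) (x : F) : algC :=
  if insub x is Some u then chi (u : {unit F}) else 0.

Definition jacobi_sum (F : finFieldType) (chi lambda : mulCF F) : algC :=
  \sum_(u : F) mcval chi u * mcval lambda (1 - u).

Definition char_binom (F : finFieldType) (A B : mulCF F) : algC :=
  mcval B (-1) * jacobi_sum A B^-1.

Definition ff_2F1 (F : finFieldType) (A B C : mulCF F) (x : F) : algC :=
  mcval 1 x * mcval (B * C) (-1) *
  \sum_(y : F) mcval B y * mcval (B^-1 * C) (1 - y) * mcval A^-1 (1 - x * y).

Definition ff_F3 (F : finFieldType) (A A' B B' C : mulCF F) (x y : F) : algC :=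
  mcval 1 (x * y) * mcval (B * B') (-1) *
  \sum_(u : F) \sum_(v : F)
    mcval B u * mcval B' v * mcval (C * B^-1 * B'^-1) (1 - u - v)
    * mcval A^-1 (1 - u * x) * mcval A'^-1 (1 - v * y).

(* Main.v *)
Require Import Defs.
From HB Require Import structures.
From mathcomp Require Import all_boot all_order all_algebra all_fingroup all_solvable all_field all_character.
From mathcomp Require Import ring.

Set Implicit Arguments.
Unset Strict Implicit.
Unset Printing Implicit Defensive.

Import Order.TTheory GRing.Theory Num.Theory.
Local Open Scope ring_scope.

(** Multiply the expansion of F3(A, A'theta; B, B'; C; x, y) by the binomial
    coefficient of A'theta and theta and by theta(t), and sum over theta inside
    the double sum over u and v.  Only the factor coming from 1 - vy depends on
    theta, so everything reduces to a one-variable identity, the binomial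
    theorem for characters:
    if z != 0, the sum over theta of the binomial coefficient of A theta and
    theta, times theta(z), is (q - 1) A^-1(1 - z)
    ([char_binomial_theorem]).  It holds because orthogonality leaves at most
    one term of the Jacobi sum, the solution w = 1 / (1 - z) of
    - w z / (1 - w) = 1; for z = 1 there is no solution, in agreement with
    A^-1(0) = 0.

    Applied with z = t / (1 - vy), it replaces A'^-1(1 - vy) by
    A'^-1(1 - t - vy) in the double sum, provided that vy != 1; for vy = 1 the
    original term is zero ([char_binomial_theorem_div]).  The double sum with
    A'^-1(1 - t - vy) and without restriction on v is, up to A'^-1(1 - t), the
    series F3 at y / (1 - t).  What has to be subtracted is its part v = 1 / y,
    a sum over u alone, and rescaling u by 1 - 1/y turns this into the
    2F1 series at x (1 - 1/y) = - x (1 - y) / y. *)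

(** * Values of multiplicative characters on the field *)

Section CharacterValues.

Variable F : finFieldType.
Implicit Types (chi A B : mulCF F) (x y z : F).

Lemma mcval0 chi : mcval chi 0 = 0.
Proof. by rewrite /mcval; case: insubP => //= u; rewrite unitr0. Qed.

Lemma mcval_unit chi (u : {unit F}) : mcval chi (val u) = chi u.
Proof. by rewrite /mcval valK. Qed.

Lemma mcval_trivial x : mcval (1 : mulCF F) x = (x != 0)%:R.
Proof.
have [->|x0] := eqVneq x 0; first by rewrite mcval0.
have xU : x \is a GRing.unit by rewrite unitfE.
by rewrite -[x]/(val (FinRing.Unit xU)) mcval_unit cfun1E inE.
Qed.

Lemma mcvalMchar A B x : mcval (A * B) x = mcval A x * mcval B x.
Proof.
by rewrite /mcval; case: insub => [u|]; rewrite ?mulr0 // cfunE.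
Qed.

Lemma mcval1 chi : chi \is a linear_char -> mcval chi 1 = 1.
Proof.
by move=> Lchi; rewrite -[1]/(val (1%g : {unit F})) mcval_unit lin_char1.
Qed.

Lemma mcvalM chi x y : chi \is a linear_char ->
  mcval chi (x * y) = mcval chi x * mcval chi y.
Proof.
move=> Lchi.
have [->|x0] := eqVneq x 0; first by rewrite mul0r mcval0 mul0r.
have [->|y0] := eqVneq y 0; first by rewrite mulr0 mcval0 mulr0.
have xU : x \is a GRing.unit by rewrite unitfE.
have yU : y \is a GRing.unit by rewrite unitfE.
rewrite -[x]/(val (FinRing.Unit xU)) -[y]/(val (FinRing.Unit yU)).
rewrite -[X in mcval chi X = _]/(val (FinRing.Unit xU * FinRing.Unit yU)%g).
by rewrite !mcval_unit lin_charM ?inE.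
Qed.

(** Valid at 0 too, thanks to the convention 0^-1 = 0: both sides vanish. *)
Lemma mcvalVchar chi x : chi \is a linear_char ->
  mcval chi^-1 x = mcval chi x^-1.
Proof.
move=> Lchi; have [->|x0] := eqVneq x 0; first by rewrite invr0 !mcval0.
have xU : x \is a GRing.unit by rewrite unitfE.
rewrite -[x]/(val (FinRing.Unit xU)).
rewrite -[X in _ = mcval _ X]/(val (FinRing.Unit xU)^-1%g) !mcval_unit.
by rewrite invr_lin_char // cfunE lin_charV_conj ?inE.
Qed.

Lemma mcvalMVchar chi x : chi \is a linear_char -> x != 0 ->
  mcval chi x * mcval chi^-1 x = 1.
Proof.
by move=> Lchi x0; rewrite mcvalVchar // -mcvalM // divff // mcval1.
Qed.

Lemma unit_irr_lin (i : Iirr [set: {unit F}]) : 'chi_i \is a linear_char.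
Proof.
apply/char_abelianP; apply/centsP => u _ v _.
by apply: val_inj; rewrite /= mulrC.
Qed.

(** Second orthogonality between z and 1: the units form an abelian group, so
    every irreducible character is linear and conjugacy is equality. *)
Lemma mcval_orthogonality z :
  \sum_(i : Iirr [set: {unit F}] | 'chi_i \is a linear_char) mcval 'chi_i z
    = (#|F|%:R - 1) * (z == 1)%:R.
Proof.
rewrite (eq_bigl predT); last by move=> i; rewrite unit_irr_lin.
have [->|z0] := eqVneq z 0.
  by rewrite big1 => [|i _]; rewrite ?mcval0 // eq_sym oner_eq0 mulr0.
have zU : z \is a GRing.unit by rewrite unitfE.
have := second_orthogonality_relation (FinRing.Unit zU) (in_setT (1%g : {unit F})).
rewrite class1G inE -val_eqE /=.
under eq_bigr => i _ do
  rewrite lin_char1 ?unit_irr_lin // conjC1 mulr1 -mcval_unit /=.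
move=> ->; case: (z == 1); last by rewrite mulr0n mulr0.
rewrite mulr1n mulr1.
have -> : ('C_[set: {unit F}][FinRing.Unit zU])%g = [set: {unit F}].
  apply/setP => u; rewrite in_setI in_setT /=; apply/cent1P.
  by apply: val_inj; rewrite /= mulrC.
rewrite card_finField_unit -[in RHS](prednK (_ : 0 < #|F|)%N) ?card_gt0.
  by rewrite -natr1 addrK.
by apply/card_gt0P; exists 0.
Qed.

End CharacterValues.

(** * The binomial theorem for characters *)

Section BinomialTheorem.

Variable F : finFieldType.
Implicit Types (A : mulCF F) (i : Iirr [set: {unit F}]).

(** Collecting the sign theta(-1), theta(w) and theta^-1(1 - w) into one value
    of theta is what makes orthogonality applicable. *)
Lemma char_binomE A i :
  char_binom (A * 'chi_i) 'chi_i
    = \sum_(w : F) mcval A w * mcval 'chi_i (- w / (1 - w)).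
Proof.
have Li := unit_irr_lin i.
rewrite /char_binom /jacobi_sum mulr_sumr; apply: eq_bigr => w _.
rewrite mcvalMchar mcvalVchar // -[- w]mulN1r !mcvalM //; ring.
Qed.

Lemma char_binomial_theorem A x : A \is a linear_char -> x != 0 ->
  \sum_(i : Iirr [set: {unit F}] | 'chi_i \is a linear_char)
     char_binom (A * 'chi_i) 'chi_i * mcval 'chi_i x
  = (#|F|%:R - 1) * mcval A^-1 (1 - x).
Proof.
move=> LA x0.
have -> : \sum_(i : Iirr [set: {unit F}] | 'chi_i \is a linear_char)
     char_binom (A * 'chi_i) 'chi_i * mcval 'chi_i x =
   \sum_(w : F) (#|F|%:R - 1) * (mcval A w * (- w / (1 - w) * x == 1)%:R).
  under eq_bigr => i Li do rewrite char_binomE mulr_suml.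
  rewrite exchange_big; apply: eq_bigr => w _ /=.
  rewrite mulrCA -mcval_orthogonality mulr_sumr; apply: eq_bigr => i Li.
  by rewrite (mcvalM (- w / (1 - w))) // mulrA.
rewrite -mulr_sumr; congr (_ * _); rewrite mcvalVchar //.
have solE w : (- w / (1 - w) * x == 1) = (x != 1) && (w == (1 - x)^-1).
  have [->|w1] := eqVneq w 1.
    rewrite subrr invr0 mulr0 mul0r eq_sym oner_eq0.
    apply/esym/negP => /andP[_ /eqP/(congr1 GRing.inv)].
    rewrite invr1 invrK => /eqP.
    by rewrite -subr_eq0 opprB addrC subrK (negPf x0).
  have w1' : 1 - w != 0 by rewrite subr_eq0 eq_sym.
  have [->|x1] := eqVneq x 1.
    apply/negP => /eqP /(congr1 (fun z => z * (1 - w))).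
    rewrite mulr1 divfK // mul1r => /eqP.
    by rewrite -subr_eq opprK addNr eq_sym oner_eq0.
  have x1' : 1 - x != 0 by rewrite subr_eq0 eq_sym.
  rewrite -[RHS](inj_eq (mulIf x1')) mulVf // -[LHS](inj_eq (mulIf w1')).
  rewrite mulrAC divfK // mul1r -subr_eq0 -[RHS]subr_eq0.
  by congr (_ == 0); ring.
under eq_bigr => w _ do rewrite solE.
have [->|x1] := eqVneq x 1.
  by rewrite subrr invr0 mcval0 big1 // => w _; rewrite mulr0.
rewrite (bigD1 (1 - x)^-1) //= eqxx mulr1 big1 ?addr0 // => w /negPf ->.
by rewrite mulr0.
Qed.

(** The binomial theorem at t / s, cleared of denominators; the factor
    [mcval 1 s] records that the left-hand side vanishes at s = 0 even though
    A^-1(s - t) need not. *)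
Lemma char_binomial_theorem_div A s t : A \is a linear_char -> t != 0 ->
  \sum_(i : Iirr [set: {unit F}] | 'chi_i \is a linear_char)
     char_binom (A * 'chi_i) 'chi_i * mcval (A * 'chi_i)^-1 s * mcval 'chi_i t
  = (#|F|%:R - 1) * (mcval 1 s * mcval A^-1 (s - t)).
Proof.
move=> LA t0; rewrite mcval_trivial.
have [->|s0] := eqVneq s 0.
  by rewrite mul0r mulr0 big1 // => i _; rewrite mcval0 mulr0 mul0r.
have -> : s - t = s * (1 - t / s) by rewrite mulrBr mulr1 mulrCA divff ?mulr1.
rewrite mul1r mcvalM ?rpredV // mulrCA.
rewrite -char_binomial_theorem ?mulf_neq0 ?invr_eq0 // mulr_sumr.
apply: eq_bigr => i Li.
rewrite mcvalVchar ?rpredM // mcvalMchar (mcvalVchar _ LA) (mcvalM t) //.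
ring.
Qed.

End BinomialTheorem.

(** * The generating function *)

Section Appell.

Variable F : finFieldType.
Implicit Types (A B C : mulCF F) (x y t u v : F).

(** Isolates the part of the summand of F3 that neither the sum over theta nor
    the change from y to y / (1 - t) affects. *)
Definition F3_kernel A B B' C x u v : algC :=
  mcval B u * mcval B' v * mcval (C * B^-1 * B'^-1) (1 - u - v)
  * mcval A^-1 (1 - u * x).

Lemma ff_F3_kernelE A A' B B' C x y : y != 0 ->
  ff_F3 A A' B B' C x y
    = mcval 1 x * mcval (B * B') (-1) *
      \sum_u \sum_v F3_kernel A B B' C x u v * mcval A'^-1 (1 - v * y).
Proof. by move=> y0; rewrite /ff_F3 !mcval_trivial mulf_eq0 (negPf y0) orbF. Qed.

(** For each u and v the dependence on theta is the one of the binomial theorem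
    with s = 1 - v y; the factor [mcval 1 (1 - v * y)] is what later produces the
    2F1 term. *)
Lemma sum_char_binom_F3 A A' B B' C x y t :
    A' \is a linear_char -> y != 0 -> t != 0 ->
  \sum_(i : Iirr [set: {unit F}] | 'chi_i \is a linear_char)
     char_binom (A' * 'chi_i) 'chi_i * ff_F3 A (A' * 'chi_i) B B' C x y
     * mcval 'chi_i t
  = (#|F|%:R - 1) * (mcval 1 x * mcval (B * B') (-1) *
      \sum_u \sum_v F3_kernel A B B' C x u v
        * (mcval 1 (1 - v * y) * mcval A'^-1 (1 - v * y - t))).
Proof.
move=> LA' y0 t0.
under eq_bigr => i _ do
  rewrite ff_F3_kernelE // mulrCA -mulrA mulr_sumr mulr_suml.
rewrite -mulr_sumr mulrCA exchange_big /=; congr (_ * _).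
rewrite mulr_sumr; apply: eq_bigr => u _.
under eq_bigr => i _ do rewrite mulr_sumr mulr_suml.
rewrite exchange_big mulr_sumr /=; apply: eq_bigr => v _.
rewrite mulrCA -char_binomial_theorem_div // mulr_sumr.
by apply: eq_bigr => i _; ring.
Qed.

(** Because (1 - t) (1 - v y / (1 - t)) = 1 - v y - t. *)
Lemma ff_F3_rescale A A' B B' C x y t :
    A' \is a linear_char -> y != 0 -> t != 1 ->
  mcval A'^-1 (1 - t) * ff_F3 A A' B B' C x (y / (1 - t))
  = mcval 1 x * mcval (B * B') (-1) *
      \sum_u \sum_v F3_kernel A B B' C x u v * mcval A'^-1 (1 - v * y - t).
Proof.
move=> LA' y0 t1; have t1' : 1 - t != 0 by rewrite subr_eq0 eq_sym.
rewrite ff_F3_kernelE ?mulf_neq0 ?invr_eq0 // mulrCA; congr (_ * _).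
rewrite mulr_sumr; apply: eq_bigr => u _.
rewrite mulr_sumr; apply: eq_bigr => v _.
rewrite mulrCA -mcvalM ?rpredV //; congr (_ * mcval _ _).
by field.
Qed.

(** Writing k for 1 - 1/y = - (1 - y) / y, the substitution u = k s turns
    1 - u - 1/y into k (1 - s) and 1 - u x into 1 - k x s. *)
Lemma F3_slice_2F1 A B B' C x y :
    B \is a linear_char -> B' \is a linear_char -> C \is a linear_char ->
    y != 0 -> y != 1 ->
  mcval 1 x * mcval (B * B') (-1) * \sum_u F3_kernel A B B' C x u y^-1
  = mcval B' (-1) * mcval C^-1 y * mcval (B'^-1 * C) (1 - y)
    * ff_2F1 A B (B'^-1 * C) (- (x * (1 - y) / y)).
Proof.
move=> LB LB' LC y0 y1; have y1' : 1 - y != 0 by rewrite subr_eq0 eq_sym.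
pose k : F := -1 * ((1 - y) * y^-1).
have k0 : k != 0 by rewrite !mulf_neq0 ?oppr_eq0 ?invr_eq0 ?oner_eq0.
rewrite /ff_2F1 !mcval_trivial oppr_eq0 !mulf_eq0 invr_eq0 (negPf y0).
rewrite (negPf y1') !orbF (reindex_inj (mulfI k0)) /=.
rewrite !mulr_sumr; apply: eq_bigr => s _.
rewrite /F3_kernel.
have -> : 1 - k * s - y^-1 = k * (1 - s) by rewrite /k; field.
have -> : 1 - k * s * x = 1 - - (x * (1 - y) / y) * s by rewrite /k; field.
have LBV : B^-1 \is a linear_char by rewrite rpredV.
have LB'V : B'^-1 \is a linear_char by rewrite rpredV.
(* The factors by which the two sides differ after expansion. *)
have cancel : mcval B k * mcval B^-1 k * (mcval B' y^-1 * mcval B'^-1 y^-1) = 1.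
  by rewrite !mcvalMVchar ?mulr1 // invr_eq0.
rewrite !mcvalMchar (mcvalVchar y LC) -[RHS]mulr1 -cancel.
by rewrite (mcvalM k s LB) !(mcvalM k (1 - s)) // /k !mcvalM //; ring.
Qed.

End Appell.

Theorem theorem4p2 (F : finFieldType) (A A' B B' C : mulCF F)
  (hA : A \is a linear_char) (hA' : A' \is a linear_char)
  (hB : B \is a linear_char) (hB' : B' \is a linear_char)
  (hC : C \is a linear_char)
  (x y t : F) (hy0 : y != 0) (hy1 : y != 1) (ht0 : t != 0) (ht1 : t != 1) :
  (#|F|%:R - 1)^-1 *
    (\sum_(i : Iirr [set: {unit F}] | 'chi_i \is a linear_char)
       char_binom (A' * 'chi_i) 'chi_i * ff_F3 A (A' * 'chi_i) B B' C x y
       * mcval 'chi_i t)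
  = mcval A'^-1 (1 - t) * ff_F3 A A' B B' C x (y / (1 - t))
    - mcval A'^-1 (- t) * mcval B' (-1) * mcval C^-1 y
      * mcval (B'^-1 * C) (1 - y)
      * ff_2F1 A B (B'^-1 * C) (- (x * (1 - y) / y)).
Proof.
have q1 : #|F|%:R - 1 != 0 :> algC.
  by rewrite subr_eq0 -[1]/(1%:R) eqr_nat gtn_eqF // finNzRing_gt1.
rewrite sum_char_binom_F3 // mulKf // ff_F3_rescale //.
have -> : mcval A'^-1 (- t) * mcval B' (-1) * mcval C^-1 y
    * mcval (B'^-1 * C) (1 - y)
    * ff_2F1 A B (B'^-1 * C) (- (x * (1 - y) / y))
  = mcval 1 x * mcval (B * B') (-1) * (\sum_u F3_kernel A B B' C x u y^-1)
    * mcval A'^-1 (- t).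
  by rewrite F3_slice_2F1 //; ring.
rewrite -[X in _ - X]mulrA -mulrBr; congr (_ * _).
rewrite mulr_suml -sumrB; apply: eq_bigr => u _.
(* The two sums over v differ only at v = 1/y, where 1 - v y vanishes. *)
rewrite (bigD1 y^-1) //= [in RHS](bigD1 y^-1) //= mulVf // subrr mcval0 mul0r.
rewrite mulr0 add0r sub0r addrAC subrr add0r; apply: eq_bigr => v vy.
rewrite mcval_trivial subr_eq0 eq_sym.
by rewrite -(inj_eq (mulIf (_ : y^-1 != 0))) ?invr_eq0 // mulfK // mul1r vy mul1r.
Qed.
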